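(* Let $\mathbb{F}$ be a field of characteristic $2$. Let $n,t\in\mathbb{N}$, let $0\le a<t$ with $a\le n$, and let $c\in\mathbb{N}_0$ be maximal such that $a+ct\le n$. Let $2^\tau$ be the least two-power appearing in the binary form of $t$. The chain complex of $\mathbb{F}S_n$-modules $$0\to\mathbb{F}\Omega_{a+ct}\xrightarrow{\varphi^{(t)}_{a+ct}}\mathbb{F}\Omega_{a+(c-1)t}\xrightarrow{\varphi^{(t)}_{a+(c-1)t}}\cdots\xrightarrow{\varphi^{(t)}_{a+2t}}\mathbb{F}\Omega_{a+t}\xrightarrow{\varphi^{(t)}_{a+t}}\mathbb{F}\Omega_a\to 0$$ is exact in every degree if and only if one of the following holds: (a) $n=2a+t$ and $a<2^\tau$; (b) $t$ is a two-power and $n\equiv 2a+t \pmod{2t}$. Moreover, if either (a) or (b) holds then the chain complex is split exact in every degree.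
   Context: $\mathbb{N}=\{1,2,\dots\}$, $\mathbb{N}_0=\{0,1,2,\dots\}$, and $S_n$ is the symmetric group of degree $n$. For $k\in\mathbb{Z}$, $\Omega_k$ is the set of $k$-subsets of $\{1,\dots,n\}$ (empty if $k<0$ or $k>n$), and $\mathbb{F}\Omega_k$ is the permutation $\mathbb{F}S_n$-module with basis $\Omega_k$. Maps are written on the right. The multistep boundary map $\varphi^{(t)}_k:\mathbb{F}\Omega_k\to\mathbb{F}\Omega_{k-t}$ is the $\mathbb{F}S_n$-homomorphism defined by $Y\varphi^{(t)}_k=\sum_{X\subseteq Y,\,|X|=k-t}X$ for $Y\in\Omega_k$; in characteristic $2$, $\varphi^{(t)}_{k+t}\varphi^{(t)}_k=0$ for $t\ge1$. The complex is exact in degree $k$ if $\ker\varphi^{(t)}_k=\operatorname{im}\varphi^{(t)}_{k+t}$. It is split exact in degree $k$ if in addition there is an $\mathbb{F}S_n$-submodule $C_k$ of $\mathbb{F}\Omega_k$ with $\mathbb{F}\Omega_k=\ker\varphi^{(t)}_k\oplus C_k$. A two-power is a number $2^\beta$ with $\beta\in\mathbb{N}_0$; $2^\beta$ appears in the binary form of $t$ if the coefficient of $2^\beta$ in the binary expansion of $t$ is $1$.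
   Formalization: The equivalence is stated only for t > 1: for t = 1 and n even (e.g. n = 2, a = 0) the complex is exact although neither (a) nor (b) holds. That (a) or (b) implies split exactness is kept for all t. *)

(* Defs.v *)
From mathcomp Require Import all_boot all_order all_algebra all_fingroup.
From mathcomp Require Import mxrepresentation.

Set Implicit Arguments.
Unset Strict Implicit.
Unset Printing Implicit Defensive.

Import GRing.Theory.
Local Open Scope ring_scope.

(* The index is an int because Omega_(k - t) must be empty for k < t, where
   subtraction on nat would truncate to Omega_0. *)
Definition Omega (n : nat) (k : int) : {set {set 'I_n}} :=
  [set Y : {set 'I_n} | #|Y|%:Z == k].

(* A vector of the module F Omega_k is a row vector of length #|Omega n k|,
   whose i-th coordinate is the coefficient of the k-subset enum_val i.  Group
   elements and homomorphisms act by multiplication on the right. *)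

Definition Omega_mx (F : fieldType) (n : nat) (k : int) (s : 'S_n) :
    'M[F]_#|Omega n k| :=
  \matrix_(i, j) (s @: (enum_val i : {set 'I_n}) == enum_val j)%:R.

Lemma Omega_mx_repr (F : fieldType) (n : nat) (k : int) :
  mx_repr [set: 'S_n] (@Omega_mx F n k).
Proof.
split=> [|s u _ _]; apply/matrixP=> i j; rewrite !mxE.
  have -> : (1%g : 'S_n) @: enum_val i = enum_val i.
    by rewrite (eq_imset _ (@perm1 _)) imset_id.
  by rewrite (inj_eq enum_val_inj).
have su_in : s @: enum_val i \in Omega n k.
  have := enum_valP i; rewrite !inE card_imset //; exact: perm_inj.
rewrite (bigD1 (enum_rank_in su_in (s @: enum_val i))) //= !mxE.
rewrite enum_rankK_in // eqxx mul1r big1 ?addr0 => [|l ne_l].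
  by rewrite -imset_comp (eq_imset _ (permM s u)).
rewrite !mxE; case: eqP => [e|_]; last by rewrite mul0r.
by case/eqP: ne_l; apply: enum_val_inj; rewrite enum_rankK_in.
Qed.

Definition Omega_repr (F : fieldType) (n : nat) (k : int) :
    mx_representation F [set: 'S_n] #|Omega n k| :=
  MxRepresentation (Omega_mx_repr F n k).

(* The map F Omega_k -> F Omega_l sending Y to the sum of the l-subsets of Y.
   The multistep boundary map phi^(t)_k is boundary F n k (k - t).  The target
   l is a separate argument because (k + t) - t is not convertible to k, while
   the image of phi^(t)_(k+t) has to be compared with subspaces of
   F Omega_k. *)
Definition boundary (F : fieldType) (n : nat) (k l : int) :
    'M[F]_(#|Omega n k|, #|Omega n l|) :=
  \matrix_(i, j) ((enum_val j : {set 'I_n}) \subset (enum_val i : {set 'I_n}))%:R.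

(* The image of a linear map is the row space of its matrix, and
   (_ == _)%MS is equality of row spaces. *)
Definition exact_in_degree (F : fieldType) (n t : nat) (k : int) : Prop :=
  (kermx (boundary F n k (k - t%:Z)) == boundary F n (k + t%:Z) k)%MS.

Definition split_exact_in_degree (F : fieldType) (n t : nat) (k : int) :
    Prop :=
  exact_in_degree F n t k /\
  exists C : 'M[F]_#|Omega n k|,
    [/\ mxmodule (Omega_repr F n k) C,
        (kermx (boundary F n k (k - t%:Z)) + C == 1%:M)%MS
      & mxdirect (kermx (boundary F n k (k - t%:Z)) + C)].

Definition two_power (m : nat) : Prop := exists b : nat, m = (2 ^ b)%N.

Definition appears_in_binary (b t : nat) : bool := odd (t %/ 2 ^ b).

(* Main.v *)
(* Write D for the boundary map of step t and U for its transpose.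

   If (a) or (b) holds then D U + U D = 1 in every degree of the complex: the
   coefficient at a pair (X, Y) with d = #|X :\: Y| is
   'C(n - k - d, t - d) + 'C(k - d, t - d), which is [d = 0] modulo 2.  So U is
   an equivariant contracting homotopy, and its composite with D splits ker D.

   Conversely, an involution f of the points and a set Y0 that meets each of its
   2-cycles in one point define the indicator vector of the sets with the same
   property that agree with Y0 on the fixed points of f.  It is killed by D when
   Y0 contains fewer than t fixed points, because exchanging the two points of a
   suitable 2-cycle pairs off the terms of each coefficient; dually, it is
   killed by U when fewer than t fixed points lie outside Y0.

   If |n - 2k| < t and t > 1, two such involutions whose 2-cycles form a path
   give a vector in ker D and a functional vanishing on im D whose pairing is 1,
   so the complex is not exact in degree k.  Hence exactness everywhere forces
   n = 2a + t modulo 2t.  If moreover t is not a two-power, then q = 2^tau < t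
   and im D lies in the kernel of the boundary map of step q, as 'C(q + t, q) is
   even; a vector as above with j fixed points in Y0, q <= j < t, lies in ker D
   but not in that kernel.  The degrees a and a + t then give (a). *)
Require Import Defs.
From mathcomp Require Import all_boot all_order all_algebra all_fingroup.
From mathcomp Require Import mxrepresentation zify.

Set Implicit Arguments.
Unset Strict Implicit.
Unset Printing Implicit Defensive.

Import GRing.Theory.
Local Open Scope ring_scope.

(** * Parity of binomial coefficients, and a subset count *)

(** Modulo 2, (1 + z)^(x + 2^s) = (1 + z)^x (1 + z^(2^s)); compare coefficients of z^e. The
    induction uses the case [s] twice, and the two middle terms cancel. *)
Lemma odd_binD_pow2 s x e :
  odd 'C(x + 2 ^ s, e) =
  odd 'C(x, e) (+) ((2 ^ s <= e)%N && odd 'C(x, e - 2 ^ s)).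
Proof.
elim: s x e => [|s IHs] x e.
  by case: e => [|e]; rewrite expn0 addn1 ?bin0 // binS oddD subn1.
rewrite expnS mul2n -addnn addnA !IHs.
case: (leqP (2 ^ s) e) => [le_se|lt_es] /=; last first.
  by rewrite [(_ + _ <= e)%N]leqNgt (leq_trans lt_es) ?leq_addr ?addbF.
rewrite -addbA addKb -leq_subRL // subnDA; congr (_ (+) _).
Qed.

Lemma odd_bin_mod s x e : (e < 2 ^ s)%N ->
  odd 'C(x, e) = odd 'C(x %% 2 ^ s, e).
Proof.
move=> lt_es; rewrite {1}(divn_eq x (2 ^ s)) addnC.
elim: (x %/ _)%N => [|q IHq]; first by rewrite mul0n addn0.
by rewrite mulSnr addnA odd_binD_pow2 leqNgt lt_es addbF.
Qed.

Lemma odd_bin_pow2 s x : odd 'C(x, 2 ^ s) = odd (x %/ 2 ^ s).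
Proof.
rewrite {1}(divn_eq x (2 ^ s)) addnC.
elim: (x %/ _)%N => [|q IHq].
  by rewrite mul0n addn0 bin_small // ltn_pmod ?expn_gt0.
by rewrite mulSnr addnA odd_binD_pow2 leqnn subnn bin0 IHq addbT.
Qed.

(** Pascal's rule splits the coefficient into two terms that are equal by symmetry. This makes
    consecutive boundary maps compose to 0. *)
Lemma odd_bin_double t : (0 < t)%N -> odd 'C(t + t, t) = false.
Proof.
case: t => // t _; rewrite addSn binS oddD -(bin_sub (leq_addr t.+1 t)) addKn.
exact: addbb.
Qed.

Lemma natr_odd_pchar2 (R : nzRingType) m : 2%N \in [pchar R] ->
  m%:R = (odd m)%:R :> R.
Proof.
move=> /pcharf0 c2; rewrite -[in LHS](odd_double_half m) natrD -muln2 natrM.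
by rewrite c2 mulr0 addr0.
Qed.

(** Removing [A] is a bijection onto the subsets of [B :\: A] of size [l - #|A|]. The case split is
    there because for [l < #|A|] truncated subtraction would turn the binomial coefficient into
    1. *)
Lemma card_between (T : finType) (A B : {set T}) (l : nat) : A \subset B ->
  #|[set Z : {set T} | [&& A \subset Z, Z \subset B & #|Z| == l]]| =
  if (#|A| <= l)%N then 'C(#|B| - #|A|, l - #|A|) else 0%N.
Proof.
move=> sAB; case: leqP => [le_Al|lt_lA]; last first.
  apply/eqP; rewrite cards_eq0; apply/eqP/setP=> Z; rewrite !inE.
  apply/negP=> /and3P[/subset_leq_card + _ /eqP eZ].
  by rewrite eZ leqNgt lt_lA.
have <- : #|B :\: A| = (#|B| - #|A|)%N by rewrite cardsD (setIidPr sAB).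
rewrite -cards_draws; set S := [set Z | _].
have <- : #|(fun Z => Z :\: A) @: S| = #|S|.
  apply: card_in_imset => Z1 Z2; rewrite !inE => /and3P[s1 _ _] /and3P[s2 _ _].
  move=> e; rewrite -(setID Z1 A) -(setID Z2 A) e.
  by rewrite (setIidPr s1) (setIidPr s2).
apply: eq_card => W; apply/imsetP/idP => [[Z + ->]|]; rewrite !inE.
  by case/and3P=> sAZ sZB /eqP<-; rewrite setSD //= cardsD (setIidPr sAZ).
rewrite subsetD => /andP[/andP[sWB dWA] /eqP cW].
exists (W :|: A); last by rewrite setDUl setDv setU0; apply/esym/setDidPl.
rewrite inE subsetUr subUset sWB sAB cardsU (disjoint_setI0 dWA) cards0.
by rewrite cW subn0 subnK ?eqxx.
Qed.

(** * Products of boundary maps and their transposes *)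

Section Omega.

Variables (F : fieldType) (n : nat).

Lemma in_Omega k (Y : {set 'I_n}) : (Y \in Omega n k%:Z) = (#|Y| == k).
Proof. by rewrite inE eqz_nat. Qed.

Lemma in_OmegaD k t (Y : {set 'I_n}) :
  (Y \in Omega n (k%:Z + t%:Z)) = (#|Y| == (k + t)%N).
Proof. by rewrite -PoszD in_Omega. Qed.

Lemma in_OmegaB k t (Y : {set 'I_n}) :
  (Y \in Omega n (k%:Z - t%:Z)) = ((#|Y| + t)%N == k).
Proof. by rewrite inE eq_sym subr_eq -PoszD eqz_nat eq_sym. Qed.

Lemma sum_Omega k (P : pred {set 'I_n}) :
  \sum_(i < #|Omega n k|) (P (enum_val i))%:R =
  #|[set Y in Omega n k | P Y]|%:R :> F.
Proof.
rewrite -(big_enum_val (fun Y => (P Y)%:R)) -sum1_card natr_sum big_mkcond.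
rewrite [RHS]big_mkcond; apply: eq_bigr => Y _.
by rewrite !inE; case: (_ == k) (P Y) => [] [].
Qed.

Lemma boundary_comp k l r (i : 'I_#|Omega n k|) (j : 'I_#|Omega n r|) :
  (boundary F n k l *m boundary F n l r) i j =
  #|[set Z in Omega n l |
      (enum_val j \subset Z) && (Z \subset (enum_val i : {set 'I_n}))]|%:R.
Proof.
rewrite -sum_Omega mxE; apply: eq_bigr => h _; rewrite !mxE -natrM mulnb.
by rewrite andbC.
Qed.

Lemma boundary_down_up k l (i j : 'I_#|Omega n k|) :
  (boundary F n k l *m (boundary F n k l)^T) i j =
  #|[set Z in Omega n l |
      Z \subset (enum_val i : {set 'I_n}) :&: enum_val j]|%:R.
Proof.
rewrite -sum_Omega mxE; apply: eq_bigr => h _; rewrite !mxE -natrM mulnb.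
by rewrite subsetI.
Qed.

Lemma boundary_up_down k l (i j : 'I_#|Omega n k|) :
  ((boundary F n l k)^T *m boundary F n l k) i j =
  #|[set Z in Omega n l |
      (enum_val i : {set 'I_n}) :|: enum_val j \subset Z]|%:R.
Proof.
rewrite -sum_Omega mxE; apply: eq_bigr => h _; rewrite !mxE -natrM mulnb.
by rewrite subUset.
Qed.

(** With d = [#|X :\: Y|], the intersection has k - d points, and choosing k - t of them amounts to
    omitting t - d. For t > k both sides are 0. *)
Lemma card_Omega_subI k t (X Y : {set 'I_n}) : #|X| = k -> #|Y| = k ->
  #|[set Z in Omega n (k%:Z - t%:Z) | Z \subset X :&: Y]| =
  if (#|X :\: Y| <= t)%N then 'C(k - #|X :\: Y|, t - #|X :\: Y|) else 0%N.
Proof.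
move=> cX cY; set d := #|_ :\: _|.
have cI : (#|X :&: Y| + d = k)%N by rewrite -cX -(cardsID Y X).
have cIk : #|X :&: Y| = (k - d)%N by lia.
case: (leqP t k) => [le_tk|lt_kt].
  transitivity #|[set Z : {set 'I_n} | [&& set0 \subset Z, Z \subset X :&: Y
                                         & #|Z| == (k - t)%N]]|.
    apply: eq_card => Z; rewrite inE in_OmegaB inE sub0set /= andbC.
    by congr (_ && _); lia.
  rewrite card_between ?sub0set // cards0 !subn0 cIk.
  rewrite leq0n; case: leqP => [le_dt|lt_td]; last by rewrite bin_small //; lia.
  have le_td: (t - d <= k - d)%N by lia.
  by rewrite -(bin_sub le_td); congr 'C(_, _); lia.
rewrite (_ : [set _ in _ | _] = set0).
  by rewrite cards0; case: ifP => // le_dt; rewrite bin_small //; lia.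
by apply/setP=> Z; rewrite inE in_OmegaB !inE; lia.
Qed.

Lemma card_Omega_supU k t (X Y : {set 'I_n}) : #|X| = k -> #|Y| = k ->
  #|[set Z in Omega n (k%:Z + t%:Z) | X :|: Y \subset Z]| =
  if (#|X :\: Y| <= t)%N then 'C(n - k - #|X :\: Y|, t - #|X :\: Y|) else 0%N.
Proof.
move=> cX cY; set d := #|_ :\: _|.
have cU : #|X :|: Y| = (k + d)%N.
  by have := cardsUI X Y; have := cardsID Y X; rewrite /d; lia.
transitivity #|[set Z : {set 'I_n} | [&& X :|: Y \subset Z, Z \subset setT
                                       & #|Z| == (k + t)%N]]|.
  by apply: eq_card => Z; rewrite inE in_OmegaD inE subsetT andbC.
rewrite card_between ?subsetT // cardsT card_ord cU leq_add2l.
by case: ifP => // _; congr 'C(_, _); lia.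
Qed.

Hypothesis charF : 2%N \in [pchar F].

(** Between X and Y with X inside Y there are 'C(s + t, s) sets of size k. The case s = t gives the
    complex; s = 2^tau serves to refute exactness. *)
Lemma boundary_comp_eq0 k s t : ~~ odd 'C(s + t, s) ->
  boundary F n (k%:Z + t%:Z) k%:Z *m boundary F n k%:Z (k%:Z - s%:Z) = 0.
Proof.
move=> ev; apply/matrixP=> i j; rewrite boundary_comp mxE natr_odd_pchar2 //.
have := enum_valP i; have := enum_valP j.
set X := enum_val j; set Y := enum_val i; rewrite in_OmegaB in_OmegaD.
move=> /eqP cX /eqP cY.
have -> : [set Z in Omega n k | (X \subset Z) && (Z \subset Y)] =
          [set Z : {set 'I_n} | [&& X \subset Z, Z \subset Y & #|Z| == k]].
  by apply/setP=> Z; rewrite inE in_Omega inE [RHS]andbA [RHS]andbC.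
case sXY: (X \subset Y); last first.
  rewrite (_ : [set _ | _] = set0) ?cards0 //; apply/setP=> Z; rewrite !inE.
  by apply: contraFF sXY => /and3P[sXZ /(subset_trans sXZ)].
rewrite card_between // cY ifT; last by lia.
rewrite (_ : k + t - #|X| = s + t)%N; last by lia.
by rewrite (_ : k - #|X| = s)%N ?(negPf ev); last by lia.
Qed.

(** The range of d in the hypothesis covers the values at most t that [#|X :\: Y|] takes on pairs of
    k-subsets; for larger d both counts are 0. *)
Lemma boundary_homotopy k t :
    (forall d, (d <= t)%N -> (d <= k)%N -> (d <= n - k)%N ->
      odd 'C(k - d, t - d) (+) odd 'C(n - k - d, t - d) = (d == 0)%N) ->
  boundary F n k%:Z (k%:Z - t%:Z) *m (boundary F n k%:Z (k%:Z - t%:Z))^T +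
  (boundary F n (k%:Z + t%:Z) k%:Z)^T *m boundary F n (k%:Z + t%:Z) k%:Z = 1.
Proof.
move=> H; apply/matrixP=> i j; rewrite mxE boundary_down_up boundary_up_down.
rewrite mxE -(inj_eq enum_val_inj).
have := enum_valP i; have := enum_valP j.
set Y := enum_val j; set X := enum_val i; rewrite !in_Omega.
move=> /eqP cY /eqP cX; rewrite card_Omega_subI // card_Omega_supU //.
have -> : (X == Y) = (#|X :\: Y| == 0)%N.
  by rewrite cards_eq0 setD_eq0 eqEcard cX cY leqnn andbT.
set d := #|_ :\: _|; case: leqP => [le_dt|lt_td]; last first.
  by rewrite addr0 gtn_eqF //; lia.
rewrite -natrD natr_odd_pchar2 // oddD H //.
  by rewrite -cX subset_leq_card ?subsetDl.
have : (d <= #|~: Y|)%N by rewrite subset_leq_card // setDE subsetIr.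
by have := cardsC Y; rewrite card_ord; lia.
Qed.

End Omega.

(** * Equivariance, and splitting by a contracting homotopy *)

Section Split.

Variables (F : fieldType) (n : nat).

Lemma enum_val_Omega k (Y : {set 'I_n}) : Y \in Omega n k ->
  exists i : 'I_#|Omega n k|, enum_val i = Y.
Proof. by move=> kY; exists (enum_rank_in kY Y); rewrite enum_rankK_in. Qed.

Lemma imset_Omega k (s : 'S_n) (Y : {set 'I_n}) :
  (s @: Y \in Omega n k) = (Y \in Omega n k).
Proof. by rewrite !inE card_imset //; exact: perm_inj. Qed.

Lemma imset_perm_subset (s : 'S_n) (X Y : {set 'I_n}) :
  (s @: X \subset s @: Y) = (X \subset Y).
Proof.
apply/idP/idP => [/subsetP sXY|]; last exact: imsetS.
by apply/subsetP=> x /(imset_f s)/sXY; rewrite mem_imset //; exact: perm_inj.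
Qed.

Lemma Omega_mx_comm k l (s : 'S_n) (A : 'M[F]_(#|Omega n k|, #|Omega n l|)) :
    (forall (i i' : 'I_#|Omega n k|) (j j' : 'I_#|Omega n l|),
       enum_val i' = s @: enum_val i ->
       enum_val j' = s @: enum_val j -> A i' j' = A i j) ->
  Omega_mx F k s *m A = A *m Omega_mx F l s.
Proof.
move=> HA; apply/matrixP=> i j; rewrite !mxE.
have [i' ei'] : exists i' : 'I_#|Omega n k|, enum_val i' = s @: enum_val i.
  by apply: enum_val_Omega; rewrite imset_Omega enum_valP.
have [j' ej'] : exists j' : 'I_#|Omega n l|, enum_val j = s @: enum_val j'.
  have [|j' ej'] := @enum_val_Omega l ((s^-1)%g @: enum_val j).
    by rewrite imset_Omega enum_valP.
  exists j'; rewrite ej' -imset_comp (eq_imset (g := id)) ?imset_id // => x /=.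
  by rewrite permKV.
rewrite (bigD1 i') //= (bigD1 j') //= !mxE ei' ej' !eqxx mul1r mulr1.
rewrite !big1 ?addr0 => [||h]; first exact: HA.
  move=> h neh; rewrite !mxE ej' (inj_eq (imset_inj (@perm_inj _ s))).
  by rewrite (inj_eq enum_val_inj) (negPf neh) mulr0.
by move=> neh; rewrite !mxE -ei' (inj_eq enum_val_inj) eq_sym (negPf neh) mul0r.
Qed.

Lemma boundary_equivariant k l (s : 'S_n) :
  Omega_mx F k s *m boundary F n k l = boundary F n k l *m Omega_mx F l s.
Proof.
apply: Omega_mx_comm => i i' j j' ei ej; rewrite !mxE ei ej.
by rewrite imset_perm_subset.
Qed.

Lemma tr_boundary_equivariant k l (s : 'S_n) :
  Omega_mx F l s *m (boundary F n k l)^T =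
  (boundary F n k l)^T *m Omega_mx F k s.
Proof.
apply: Omega_mx_comm => i i' j j' ei ej; rewrite !mxE ei ej.
by rewrite imset_perm_subset.
Qed.

(** A vector v of ker [B1] equals v [B2^T] [B2], so it lies in the image of [B2]. Multiplying the
    homotopy identity by [E] gives [E *m E = E], so [E] is the equivariant projection with kernel
    ker [B1], and its image is the complement. *)
Lemma homotopy_split_exact t k :
  let B1 := boundary F n k (k - t%:Z) in
  let B2 := boundary F n (k + t%:Z) k in
  B2 *m B1 = 0 -> B1 *m B1^T + B2^T *m B2 = 1%:M ->
  split_exact_in_degree F n t k.
Proof.
move=> B1 B2 B21 hB; set E := B1 *m B1^T.
have kerE : (kermx B1 *m E = 0) by rewrite mulmxA mulmx_ker mul0mx.
have B2E : B2 *m E = 0 by rewrite mulmxA B21 mul0mx.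
have EE : E *m E = E.
  by rewrite -[RHS]mul1mx -hB mulmxDl -(mulmxA B2^T) B2E mulmx0 addr0.
split.
  apply/andP; split; last exact/sub_kermxP.
  by rewrite -[X in (X <= _)%MS]mulmx1 -hB mulmxDr kerE add0r mulmxA submxMl.
exists E; split.
- apply/mxmoduleP=> s _ /=.
  rewrite -mulmxA -tr_boundary_equivariant mulmxA -boundary_equivariant.
  by rewrite -mulmxA submxMl.
- rewrite submx1 /= -hB addrC addmx_sub_adds //.
  by apply/sub_kermxP; rewrite -mulmxA B21 mulmx0.
- apply/mxdirect_addsP/eqP; rewrite -submx0; apply/rV_subP=> v.
  rewrite sub_capmx => /andP[/sub_kermxP vB1 /submxP[u ev]].
  suff -> : v = 0 by rewrite sub0mx.
  by rewrite ev -EE mulmxA -ev mulmxA vB1 mul0mx.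
Qed.

End Split.

(** * Transversals of an involution *)

Section Transversals.

Variables (T : finType) (f : T -> T) (Y0 : {set T}).
Hypothesis fK : involutive f.

(** [Y0] enters only through the fixed points of [f] that it contains; whether [Y0] itself is a
    transversal is a separate condition. *)
Definition transversals : {set {set T}} :=
  [set Y : {set T} | [forall x, (x \in Y) ==
                        if f x == x then x \in Y0 else f x \notin Y]].

Lemma transversalsP (Y : {set T}) :
  reflect (forall x, x \in Y = if f x == x then x \in Y0 else f x \notin Y)
          (Y \in transversals).
Proof. by rewrite inE; apply: (iffP forallP) => H x; apply/eqP. Qed.

Lemma mem_imset_tperm x y z (Y : {set T}) :
  (z \in tperm x y @: Y) = (tperm x y z \in Y).
Proof. by rewrite -{1}(tpermK x y z) mem_imset //; exact: perm_inj. Qed.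

Lemma imset_tperm x y (Y : {set T}) : (x \in Y) = (y \in Y) ->
  tperm x y @: Y = Y.
Proof.
by move=> e; apply/setP=> z; rewrite mem_imset_tperm; case: tpermP => [->|->|].
Qed.

Lemma transversals_swap x Y : f x != x -> Y \in transversals ->
  tperm x (f x) @: Y \in transversals.
Proof.
move=> nfx /transversalsP tY; apply/transversalsP=> z; rewrite !mem_imset_tperm.
case: tpermP => [->|->|nzx nzfx].
- by rewrite (negPf nfx) tpermR (tY x) (negPf nfx) negbK.
- by rewrite fK eq_sym (negPf nfx) tpermL (tY x) (negPf nfx).
- rewrite tY; case: ifP => // _; rewrite tpermD //; apply/eqP => e.
    by case: nzfx; rewrite e fK.
  by case: nzx; apply/esym/(inv_inj fK).
Qed.

(** Exchanging [x] and [f x] maps the counted sets that contain [x] bijectively onto those that do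
    not. *)
Lemma even_transversals x (P : pred {set T}) : f x != x ->
    (forall Y : {set T}, P (tperm x (f x) @: Y) = P Y) ->
  ~~ odd #|[set Y in transversals | P Y]|.
Proof.
move=> nfx HP; set A := [set _ in _ | _]; set B := [set Y : {set T} | x \in Y].
have AP (Y : {set T}) : Y \in A -> tperm x (f x) @: Y \in A.
  rewrite !(in_set (fun Z => _ && _)) HP => /andP[? ->].
  by rewrite transversals_swap.
have memx (Y : {set T}) : Y \in A -> (x \in tperm x (f x) @: Y) = (x \notin Y).
  rewrite inE => /andP[/transversalsP tY _].
  by rewrite mem_imset_tperm tpermL (tY x) (negPf nfx) negbK.
have swapK : involutive (fun Y : {set T} => tperm x (f x) @: Y).
  by move=> Y; apply/setP=> z; rewrite !mem_imset_tperm tpermK.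
rewrite -(cardsID B A) -(card_imset _ (inv_inj swapK)).
rewrite (_ : [set _ | _ in _] = A :\: B) ?addnn ?odd_double //.
apply/setP=> Y; apply/imsetP/idP => [[Z /setIP[AZ BZ] ->]|/setDP[AY BY]].
  by rewrite !in_setD AP // andbT inE memx // negbK; rewrite inE in BZ.
exists (tperm x (f x) @: Y); last by rewrite swapK.
by rewrite in_setI AP // inE memx //; rewrite inE in BY.
Qed.

End Transversals.

(** * Polytabloids as cycles and cocycles *)

Section Polytabloids.

Variables (F : fieldType) (n : nat) (f : 'I_n -> 'I_n) (Y0 : {set 'I_n}).
Hypothesis fK : involutive f.
Hypothesis charF : 2%N \in [pchar F].

(** In characteristic 2 signs disappear, and this is the polytabloid of a skew two-row tableau whose
    columns of length two are the 2-cycles of [f]. All transversals have the same size, so it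
    vanishes for every other [k]. *)
Definition polytabloid k : 'rV[F]_#|Omega n k| :=
  \row_i ((enum_val i : {set 'I_n}) \in transversals f Y0)%:R.

Lemma polytabloid_boundary k l j :
  (polytabloid k *m boundary F n k l) 0 j =
  #|[set Y in Omega n k |
      (Y \in transversals f Y0) && (enum_val j \subset Y)]|%:R.
Proof.
rewrite -sum_Omega mxE; apply: eq_bigr => h _.
by rewrite !mxE -natrM mulnb.
Qed.

Lemma boundary_polytabloid_tr k l i :
  (boundary F n l k *m (polytabloid k)^T) i 0 =
  #|[set Y in Omega n k |
      (Y \in transversals f Y0) && (Y \subset enum_val i)]|%:R.
Proof.
rewrite -sum_Omega mxE; apply: eq_bigr => h _.
by rewrite !mxE -natrM mulnb andbC.
Qed.

Lemma polytabloid_cycle k t : (#|[set x in Y0 | f x == x]| < t)%N ->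
  polytabloid k%:Z *m boundary F n k%:Z (k%:Z - t%:Z) = 0.
Proof.
move=> ltFt; apply/rowP=> j; rewrite polytabloid_boundary mxE.
have := enum_valP j; set X := enum_val j; rewrite in_OmegaB => /eqP cX.
set S := [set _ in _ | _].
have [->|[Y]] := set_0Vmem S; first by rewrite cards0.
rewrite inE in_Omega => /and3P[/eqP cY /transversalsP tY sXY].
(* [Y :\: X] has t points, too many for all of them to be fixed. For a moved one, [f x] is outside
   [Y], hence outside [X], and the exchange of the two preserves [X]. *)
have [x xY /andP[xX nfx]] : exists2 x, x \in Y & (x \notin X) && (f x != x).
  apply/exists_inP; apply: contraT; rewrite negb_exists_in => /forall_inP H.
  suff: (t <= #|[set x in Y0 | f x == x]|)%N.
    by rewrite leqNgt ltFt.
  have <- : #|Y :\: X| = t by rewrite cardsD (setIidPr sXY); lia.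
  apply/subset_leq_card/subsetP => x /setDP[xY xX].
  have := H x xY; rewrite xX /= negbK inE => fx; rewrite fx andbT.
  by move: xY; rewrite tY fx.
rewrite natr_odd_pchar2 // (_ : S = [set Y in transversals f Y0 |
  (#|Y| == k) && (X \subset Y)]); last first.
  by apply/setP=> Z; rewrite inE in_Omega [RHS]inE andbCA.
rewrite (negPf (even_transversals _ fK nfx _)) // => Z.
rewrite card_imset; last exact: perm_inj.
have fxX : f x \notin X.
  by apply: contraL xY => /(subsetP sXY); rewrite (tY x) (negPf nfx) negbK.
rewrite -[in RHS](imset_perm_subset (tperm x (f x))).
rewrite [tperm _ _ @: X]imset_tperm //.
by rewrite (negPf xX) (negPf fxX).
Qed.

Lemma polytabloid_cocycle k t : (#|[set x in ~: Y0 | f x == x]| < t)%N ->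
  boundary F n (k%:Z + t%:Z) k%:Z *m (polytabloid k%:Z)^T = 0.
Proof.
move=> ltFt; apply/colP=> i; rewrite boundary_polytabloid_tr mxE.
have := enum_valP i; set Z := enum_val i; rewrite in_OmegaD => /eqP cZ.
set S := [set _ in _ | _].
have [->|[Y]] := set_0Vmem S; first by rewrite cards0.
rewrite inE in_Omega => /and3P[/eqP cY /transversalsP tY sYZ].
(* Dually, [Z :\: Y] contains a moved point; its partner lies in [Y], so the whole 2-cycle is inside
   [Z]. *)
have [x xY /andP[xZ nfx]] : exists2 x, x \notin Y & (x \in Z) && (f x != x).
  apply/exists_inP; apply: contraT; rewrite negb_exists_in => /forall_inP H.
  suff: (t <= #|[set x in ~: Y0 | f x == x]|)%N.
    by rewrite leqNgt ltFt.
  have <- : #|Z :\: Y| = t by rewrite cardsD (setIidPr sYZ); lia.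
  apply/subset_leq_card/subsetP => x /setDP[xZ xY].
  have := H x xY; rewrite xZ /= negbK !inE => fx; rewrite fx andbT.
  by move: xY; rewrite tY fx.
rewrite natr_odd_pchar2 // (_ : S = [set Y in transversals f Y0 |
  (#|Y| == k) && (Y \subset Z)]); last first.
  by apply/setP=> W; rewrite inE in_Omega [RHS]inE andbCA.
rewrite (negPf (even_transversals _ fK nfx _)) // => W.
rewrite card_imset; last exact: perm_inj.
have fxZ : f x \in Z.
  by apply: (subsetP sYZ); move: xY; rewrite (tY x) (negPf nfx) negbK.
rewrite -[in RHS](imset_perm_subset (tperm x (f x))).
rewrite [tperm _ _ @: Z]imset_tperm //.
by rewrite xZ fxZ.
Qed.

End Polytabloids.

(** * Two obstructions to exactness *)

Section NotExact.

Variables (F : fieldType) (n : nat).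
Hypothesis charF : 2%N \in [pchar F].

(** The pairing of the two polytabloids counts their common transversals, here [Y0] alone. It would
    be 0 if the first were a boundary. *)
Lemma paired_cycle_not_exact f f' (Y0 : {set 'I_n}) t :
    involutive f -> involutive f' ->
    (#|[set x in Y0 | f x == x]| < t)%N ->
    (#|[set x in ~: Y0 | f' x == x]| < t)%N ->
    transversals f Y0 :&: transversals f' Y0 = [set Y0] ->
  ~ exact_in_degree F n t #|Y0|%:Z.
Proof.
move=> fK f'K ltF ltF' eI /andP[+ _]; set k := #|Y0|.
move/(submx_trans (introT sub_kermxP (polytabloid_cycle fK charF k ltF))).
case/submxP=> u ev; have := congr1 (mulmx^~ (polytabloid F f' Y0 k)^T) ev.
rewrite /= -mulmxA polytabloid_cocycle // mulmx0 => /matrixP/(_ 0 0).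
rewrite mxE [RHS]mxE.
under eq_bigr do rewrite !mxE -natrM mulnb.
rewrite (sum_Omega F k%:Z
  [pred Y | (Y \in transversals f Y0) && (Y \in transversals f' Y0)]).
rewrite (_ : [set _ in _ | _] = [set Y0]) ?cards1; first exact/eqP/oner_neq0.
apply/setP=> Y; rewrite inE in_Omega /= -in_setI eI inE.
by apply: andb_idl => /eqP->.
Qed.

Lemma cycle_not_exact f (Y0 : {set 'I_n}) t q :
    involutive f -> Y0 \in transversals f Y0 ->
    (q <= #|[set x in Y0 | f x == x]| < t)%N -> ~~ odd 'C(q + t, q) ->
  ~ exact_in_degree F n t #|Y0|%:Z.
Proof.
move=> fK tY0 /andP[/card_geqP[s [us ss sF]] ltF] ev /andP[+ _]; set k := #|Y0|.
move/(submx_trans (introT sub_kermxP (polytabloid_cycle fK charF k ltF))).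
(* [s] lists q fixed points of [f] in [Y0]. As [X] keeps all moved points of [Y0], the only
   transversal containing [X] is [Y0], so the step-q boundary has coefficient 1 at [X]. *)
case/submxP=> u ev'; set X := Y0 :\: [set x in s].
have cX : X \in Omega n (k%:Z - q%:Z).
  have sY0: [set x in s] \subset Y0.
    by apply/subsetP=> x; rewrite inE => /sF; rewrite inE => /andP[].
  have := subset_leq_card sY0; rewrite in_OmegaB cardsD (setIidPr sY0).
  by rewrite cardsE (card_uniqP us) ss; lia.
have [j ej] := enum_val_Omega cX.
have /rowP/(_ j) : polytabloid F f Y0 k%:Z *m
    boundary F n k%:Z (k%:Z - q%:Z) = 0.
  by rewrite ev' -mulmxA boundary_comp_eq0 // mulmx0.
rewrite polytabloid_boundary ej mxE.
rewrite (_ : [set _ in _ | _] = [set Y0]) ?cards1; first exact/eqP/oner_neq0.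
apply/setP=> Y; rewrite inE in_Omega in_set1.
apply/idP/eqP => [|->]; last by rewrite eqxx tY0 subsetDl.
case/and3P=> _ /transversalsP tY /subsetP sXY; move/transversalsP in tY0.
have memX x : x \in Y0 -> f x != x -> x \in Y.
  move=> xY0 nfx; apply: sXY; rewrite !inE xY0 andbT.
  by apply: contra nfx => /sF; rewrite inE => /andP[].
apply/setP=> x; rewrite tY; case: ifP => // /negbT nfx.
have := tY0 x; rewrite (negPf nfx) => ->.
apply/idP/idP => [|fxY0].
  by apply: contra => fx; apply: memX; rewrite ?fK 1?eq_sym.
apply/negP=> fxY; move: (tY x); rewrite (negPf nfx) fxY /= memX //.
by rewrite tY0 (negPf nfx).
Qed.

End NotExact.

(** * Explicit involutions and initial segments *)

Section Initial.

Variable n : nat.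

(** When p + m <= q and q + m <= n all values are below n, so the default of [insubd] is never
    reached. *)
Definition swap_blocks p q m (x : 'I_n) : 'I_n :=
  insubd x (if (p <= x < p + m)%N then x + (q - p) else
            if (q <= x < q + m)%N then x - (q - p) else x)%N.

Definition initial k : {set 'I_n} := [set x : 'I_n | (x < k)%N].

Lemma card_interval p q : (q <= n)%N ->
  #|[set x : 'I_n | (p <= x < q)%N]| = (q - p)%N.
Proof.
move=> le_qn; transitivity (\sum_(p <= i < q) 1)%N; last first.
  by rewrite sum_nat_const_nat muln1.
rewrite (big_nat_widen _ _ _ _ _ le_qn) big_geq_mkord -sum1_card.
by apply: eq_bigl => x; rewrite inE andbC.
Qed.

Lemma card_initial k : (k <= n)%N -> #|initial k| = k.
Proof. by move=> le_kn; rewrite -[RHS]subn0 -card_interval. Qed.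

Section SwapBlocks.

Variables p q m : nat.
Hypotheses (pmq : (p + m <= q)%N) (qmn : (q + m <= n)%N).
Local Notation f := (swap_blocks p q m).

Lemma swap_blocksE (x : 'I_n) : f x =
  (if (p <= x < p + m)%N then x + (q - p) else
            if (q <= x < q + m)%N then x - (q - p) else x)%N :> nat.
Proof.
rewrite val_insubd ifT //.
by case: ifP => [|_]; [lia | case: ifP => [|_]; have := ltn_ord x; lia].
Qed.

Lemma swap_blocksK : involutive f.
Proof.
move=> x; apply: val_inj => /=; rewrite swap_blocksE.
have := swap_blocksE x; move: (nat_of_ord (f x)) => y.
by case: ifP => ?; [|case: ifP => ?]; move=> ->; repeat case: ifP => ?; lia.
Qed.

Lemma swap_blocks_fix (x : 'I_n) :
  (f x == x) = (~~ (p <= x < p + m) && ~~ (q <= x < q + m))%N.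
Proof. by rewrite -val_eqE /= swap_blocksE; do 2?case: ifP => ?; lia. Qed.

End SwapBlocks.


End Initial.

(** Agreement with [Y0] starts at fixed points and passes along 2-cycles. Alternating two
    involutions thus carries it along a path. *)
Lemma transversals_agree (T : finType) (f : T -> T) (Y0 Y : {set T}) x :
    Y0 \in transversals f Y0 -> Y \in transversals f Y0 ->
  f x = x \/ (f x \in Y) = (f x \in Y0) -> (x \in Y) = (x \in Y0).
Proof.
move=> /transversalsP tY0 /transversalsP tY.
have := tY0 x; have := tY x; case: eqP => [_ -> //|nfx eY eY0 [] // e].
by rewrite eY eY0 e.
Qed.

Section Initial.

Variables (n k : nat).

Lemma initial_transversal p q m : (p + m <= k <= q)%N -> (q + m <= n)%N ->
  initial n k \in transversals (swap_blocks p q m) (initial n k).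
Proof.
move=> /andP[pmk kq] qmn; apply/transversalsP=> x.
rewrite !inE swap_blocks_fix ?swap_blocksE //; try lia.
by do 3?case: ifP => ?; lia.
Qed.

Lemma card_initial_fix q m : (m <= k <= q)%N -> (q + m <= n)%N ->
  #|[set x in initial n k | swap_blocks 0 q m x == x]| = (k - m)%N.
Proof.
move=> mkq qmn; rewrite -(@card_interval n); last lia.
by apply: eq_card => x; rewrite !inE swap_blocks_fix; lia.
Qed.

Lemma card_initialC_fix p m : (p + m <= k)%N -> (k + m <= n)%N ->
  #|[set x in ~: initial n k | swap_blocks p k m x == x]| = (n - (k + m))%N.
Proof.
move=> pmk kmn; rewrite -(@card_interval n) //.
by apply: eq_card => x; have := ltn_ord x; rewrite !inE swap_blocks_fix; lia.
Qed.

(* Alternating between the two matchings visits 0, k, 1, k + 1, ..., m, the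
   first point being fixed by the second matching. *)
Lemma transversals_path0 m : (m < k)%N -> (k + m <= n)%N ->
  transversals (swap_blocks 0 k m) (initial n k) :&:
    transversals (swap_blocks 1 k m) (initial n k) = [set initial n k].
Proof.
move=> mk kmn; set f := swap_blocks 0 k m; set f' := swap_blocks 1 k m.
have tf : initial n k \in transversals f (initial n k).
  by apply: initial_transversal; lia.
have tf' : initial n k \in transversals f' (initial n k).
  by apply: initial_transversal; lia.
apply/setP=> Y; rewrite inE in_set1; apply/andP/eqP => [[tY tY']|-> //].
have fE (x : 'I_n) := @swap_blocksE n 0 k m ltac:(lia) ltac:(lia) x.
have f'E (x : 'I_n) := @swap_blocksE n 1 k m ltac:(lia) ltac:(lia) x.
have agree i (x : 'I_n) : x = i :> nat -> (i <= m)%N ->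
    (x \in Y) = (x \in initial n k).
  elim: i x => [|i IHi] x xi im; apply: (transversals_agree tf' tY').
    by left; apply: val_inj; rewrite /= f'E; do 2?case: ifP; lia.
  right; apply: (transversals_agree tf tY); right; apply: IHi; last lia.
  rewrite fE; have : f' x = (k + i)%N :> nat by rewrite f'E; case: ifP; lia.
  by move=> ->; do 2?case: ifP; lia.
apply/setP=> x; case: (leqP x m) => [xm|mx]; first exact: agree xm.
apply: (transversals_agree tf tY); case: (leqP (k + m) x) => xkm.
  by left; apply: val_inj; rewrite /= fE; do 2?case: ifP; lia.
case: (ltnP x k) => xk.
  by left; apply: val_inj; rewrite /= fE; do 2?case: ifP; lia.
by right; apply: (agree _ _ erefl); rewrite fE; do 2?case: ifP; lia.
Qed.

(* The path is now k, 0, k + 1, 1, ..., 2 k. *)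
Lemma transversals_path1 : (k + k < n)%N ->
  transversals (swap_blocks 0 k.+1 k) (initial n k) :&:
    transversals (swap_blocks 0 k k) (initial n k) = [set initial n k].
Proof.
move=> kkn; set f := swap_blocks 0 k.+1 k; set f' := swap_blocks 0 k k.
have tf : initial n k \in transversals f (initial n k).
  by apply: initial_transversal; lia.
have tf' : initial n k \in transversals f' (initial n k).
  by apply: initial_transversal; lia.
apply/setP=> Y; rewrite inE in_set1; apply/andP/eqP => [[tY tY']|-> //].
have fE (x : 'I_n) := @swap_blocksE n 0 k.+1 k ltac:(lia) ltac:(lia) x.
have f'E (x : 'I_n) := @swap_blocksE n 0 k k ltac:(lia) ltac:(lia) x.
have agree i (x : 'I_n) : x = (k + i)%N :> nat -> (i <= k)%N ->
    (x \in Y) = (x \in initial n k).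
  elim: i x => [|i IHi] x xi im; apply: (transversals_agree tf tY).
    by left; apply: val_inj; rewrite /= fE; do 2?case: ifP; lia.
  right; apply: (transversals_agree tf' tY'); right; apply: IHi; last lia.
  rewrite f'E; have : f x = i :> nat by rewrite fE; do 2?case: ifP; lia.
  by move=> ->; case: ifP; lia.
apply/setP=> x; case: (leqP (k + k) x) => [xk|xk].
  apply: (transversals_agree tf' tY').
  by left; apply: val_inj; rewrite /= f'E; do 2?case: ifP; lia.
case: (leqP k x) => kx; first by apply: (agree (x - k)%N); lia.
apply: (transversals_agree tf' tY'); right; apply: (agree x); last lia.
by rewrite f'E; case: ifP; lia.
Qed.

End Initial.

(** * Degrees in which exactness fails *)

Section Necessity.

Variables (F : fieldType) (n : nat).
Hypothesis charF : 2%N \in [pchar F].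

Lemma middle_not_exact k t : (0 < n)%N -> (k <= n)%N -> (1 < t)%N ->
  (n < 2 * k + t)%N -> (2 * k < n + t)%N -> ~ exact_in_degree F n t k%:Z.
Proof.
move=> n0 kn t1 nk kn'; 
suff: ~ exact_in_degree F n t #|initial n k|%:Z by rewrite card_initial.
have [kk|kk] := ltnP (k + k) n.
  apply: (paired_cycle_not_exact charF _ _ _ _ (transversals_path1 kk)).
  - by apply: swap_blocksK; lia.
  - by apply: swap_blocksK; lia.
  - by rewrite card_initial_fix; lia.
  - by rewrite card_initialC_fix; lia.
(* For n = 2k the choice m = n - k would violate m < k. With m = k - 1 one fixed point is left on
   each side, which is fewer than t since t > 1. *)
pose m := (if n == k + k then k.-1 else n - k)%N.
have mk : (m < k)%N by rewrite /m; case: ifP; lia.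
have kmn : (k + m <= n)%N by rewrite /m; case: ifP; lia.
apply: (paired_cycle_not_exact charF _ _ _ _ (transversals_path0 mk kmn)).
- by apply: swap_blocksK; lia.
- by apply: swap_blocksK; lia.
- by rewrite card_initial_fix ?/m; [case: ifP | ..]; lia.
- by rewrite card_initialC_fix ?/m; [case: ifP | ..]; lia.
Qed.

(** Of the m + j points of the initial segment, m are matched with points outside it, for which 2m +
    j <= n leaves room; the other j are fixed. *)
Lemma tail_not_exact m j t q : (2 * m + j <= n)%N -> (q <= j < t)%N ->
  ~~ odd 'C(q + t, q) -> ~ exact_in_degree F n t (m + j)%N%:Z.
Proof.
move=> mjn qjt ev; have mj : (m + j <= n)%N by lia.
suff: ~ exact_in_degree F n t #|initial n (m + j)|%:Z by rewrite card_initial.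
apply: (cycle_not_exact charF (f := swap_blocks 0 (m + j) m) _ _ _ ev).
- by apply: swap_blocksK; lia.
- by apply: initial_transversal; lia.
- by rewrite card_initial_fix; lia.
Qed.

End Necessity.

(** * Arithmetic of conditions (a) and (b) *)

Lemma eqmod_sub_double k n t : (k <= n)%N ->
  n = (2 * k + t)%N %[mod 2 * t] -> (n - k)%N = (k + t)%N %[mod 2 * t].
Proof.
move=> le_kn e; apply/eqP; rewrite -(eqn_modDl k) subnKC //; apply/eqP.
by rewrite e addnA addnn mul2n.
Qed.

(** For d = 0 the two parities are bit s of k and of n - k, which differ as n - k = k + 2^s modulo
    2^(s+1). For d > 0 the lower index is below 2^s, so only the upper indices modulo 2^s matter,
    and these agree. *)
Lemma odd_bin_antipodal s k n d : (k <= n)%N ->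
    n = (2 * k + 2 ^ s)%N %[mod 2 * 2 ^ s] ->
    (d <= 2 ^ s)%N -> (d <= k)%N -> (d <= n - k)%N ->
  odd 'C(k - d, 2 ^ s - d) (+) odd 'C(n - k - d, 2 ^ s - d) = (d == 0)%N.
Proof.
move=> le_kn /(eqmod_sub_double le_kn); move: (n - k)%N => l e les lek lel.
have q_gt0 : (0 < 2 ^ s)%N by rewrite expn_gt0.
case: d les lek lel => [|d] les lek lel /=.
  rewrite !subn0 !odd_bin_pow2.
  have oddq x : odd (x %/ 2 ^ s) = odd ((x %% (2 * 2 ^ s)) %/ 2 ^ s).
    rewrite {1}(divn_eq x (2 * 2 ^ s)) mulnA divnMDl // oddD oddM andbF.
    by rewrite addFb.
  rewrite (oddq l) e -oddq divnDr ?dvdnn // divnn q_gt0 addn1 /=.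
  by rewrite addbN addbb.
have el : (l - d.+1)%N = (k - d.+1)%N %[mod 2 ^ s].
  apply/eqP; rewrite -(eqn_modDr d.+1) !subnK //.
  have /(congr1 (modn^~ (2 ^ s)%N)) := e.
  by rewrite !modn_dvdm ?dvdn_mull // modnDr => ->.
rewrite (odd_bin_mod (s := s) (l - d.+1)) ?el -?odd_bin_mod ?addbb //; lia.
Qed.

(** At k = a the first coefficient is 0 since a < t. The second is 'C(a - d + t, a), with the parity
    of 'C(a - d, a) because 2^s divides t and exceeds a. *)
Lemma odd_bin_symmetric s a t k d :
    (0 < t)%N -> (2 ^ s %| t)%N -> (a < 2 ^ s)%N ->
    k = a \/ k = (a + t)%N -> (d <= k)%N -> (d <= 2 * a + t - k)%N ->
  odd 'C(k - d, t - d) (+) odd 'C(2 * a + t - k - d, t - d) = (d == 0)%N.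
Proof.
move=> t_gt0 st lt_as; have le_st := dvdn_leq t_gt0 st.
(* Replacing k by 2a + t - k exchanges the degrees a and a + t and the two summands. *)
wlog -> : k / k = a => [IH|_].
  case=> ->; first by apply: IH; auto.
  rewrite (_ : 2 * a + t - (a + t) = a)%N; last lia.
  move=> dat da; have := IH a erefl (or_introl erefl) da.
  by rewrite (_ : 2 * a + t - a = a + t)%N 1?addbC //; last lia; apply.
move=> da dat; rewrite bin_small /=; last lia.
rewrite (_ : 2 * a + t - a - d = a - d + t)%N; last lia.
have le : (t - d <= a - d + t)%N by lia.
rewrite -(bin_sub le) (_ : a - d + t - (t - d) = a)%N; last lia.
rewrite (odd_bin_mod (s := s)) // -modnDmr (eqP st) addn0 modn_small; last lia.
case: d {le} => [|d] in da dat *; first by rewrite subn0 binn.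
by rewrite bin_small //; lia.
Qed.

(** The exponent of 2 in t is itself a position of a binary digit 1, since the cofactor is odd. *)
Lemma least_two_power_dvd t tau : (0 < t)%N ->
    (forall b, appears_in_binary b t -> (2 ^ tau <= 2 ^ b)%N) ->
  (2 ^ tau %| t)%N.
Proof.
move=> t_gt0 least; have [m co_m tE] := pfactor_coprime (isT : prime 2) t_gt0.
have /least : appears_in_binary (logn 2 t) t.
  by rewrite /appears_in_binary {1}tE mulnK ?expn_gt0 // -coprime2n.
by rewrite leq_exp2l // pfactor_dvdn.
Qed.

Lemma two_power_least t tau : (0 < t)%N -> two_power t ->
    appears_in_binary tau t ->
    (forall b, appears_in_binary b t -> (2 ^ tau <= 2 ^ b)%N) ->
  t = (2 ^ tau)%N.
Proof.
move=> t_gt0 [b tE] app least; apply/eqP.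
have le_tau := dvdn_leq t_gt0 (least_two_power_dvd t_gt0 least).
have le_taub : (tau <= b)%N by rewrite -(leq_exp2l (m := 2)) // -tE.
move: app; rewrite /appears_in_binary tE -(subnK le_taub) expnD.
rewrite mulnK ?expn_gt0 // oddX; case: (b - tau)%N => // _.
by rewrite mul1n.
Qed.

Lemma homotopy_degree_split (F : fieldType) n t k :
    2%N \in [pchar F] -> (0 < t)%N ->
    (forall d, (d <= t)%N -> (d <= k)%N -> (d <= n - k)%N ->
      odd 'C(k - d, t - d) (+) odd 'C(n - k - d, t - d) = (d == 0)%N) ->
  split_exact_in_degree F n t k%:Z.
Proof.
move=> charF t_gt0 H; apply: homotopy_split_exact; last first.
  exact: boundary_homotopy.
by apply: boundary_comp_eq0; rewrite // odd_bin_double.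
Qed.

(* The degrees k with |n - 2k| < t lie in an open interval of length t, which
   misses a residue class modulo t only if its end points are in that class. *)
Lemma exists_middle_degree n t a : (0 < t)%N -> (a < t)%N -> (a <= n)%N ->
    (2 * a + t)%N <> n %[mod 2 * t] ->
  exists i, [/\ (a + i * t <= n)%N, (n < 2 * (a + i * t) + t)%N
              & (2 * (a + i * t) < n + t)%N].
Proof.
move=> t_gt0 lt_at le_an ne; have [n_lt|le_n] := ltnP n (2 * a + t).
  by exists 0%N; split; lia.
set u := (n - (2 * a + t))%N; have nE : n = (2 * a + t + u)%N by lia.
have r_gt0 : (0 < u %% (2 * t))%N.
  rewrite lt0n; apply/eqP => r0; case: ne.
  by rewrite nE -[in RHS]modnDmr r0 addn0.
have := divn_eq u (2 * t).
have : (u %% (2 * t) < 2 * t)%N by rewrite ltn_pmod; lia.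
move=> ltr uE; exists (u %/ (2 * t)).+1; split; nia.
Qed.

(** For t = 1 the complex is the augmented chain complex of a simplex, exact for every n >= 1, while
    (a) and (b) both fail for even n. Hence the guard [1 < t] on the equivalence. *)
Theorem theorem1p3 (F : fieldType) (charF : 2%N \in [pchar F])
    (n t a c tau : nat)
    (n_gt0 : (0 < n)%N) (t_gt0 : (0 < t)%N)
    (a_lt_t : (a < t)%N) (a_le_n : (a <= n)%N)
    (c_ok : (a + c * t <= n)%N)
    (c_max : forall c' : nat, (a + c' * t <= n)%N -> (c' <= c)%N)
    (tau_appears : appears_in_binary tau t)
    (tau_least : forall b : nat, appears_in_binary b t -> (2 ^ tau <= 2 ^ b)%N) :
  let cond_a := n = (2 * a + t)%N /\ (a < 2 ^ tau)%N in
  let cond_b := two_power t /\ (n = 2 * a + t %[mod 2 * t])%N in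
  ((1 < t)%N ->
     (forall i : nat, (i <= c)%N -> exact_in_degree F n t (a + i * t)%N%:Z)
     <-> cond_a \/ cond_b)
  /\ (cond_a \/ cond_b ->
      forall i : nat, (i <= c)%N ->
        split_exact_in_degree F n t (a + i * t)%N%:Z).
Proof.
move=> cond_a cond_b.
have tau_dvd := least_two_power_dvd t_gt0 tau_least.
have splits : cond_a \/ cond_b -> forall i : nat, (i <= c)%N ->
    split_exact_in_degree F n t (a + i * t)%N%:Z.
  move=> cond i le_ic.
  have le_k : (a + i * t <= n)%N by nia.
  apply: homotopy_degree_split => // d; case: cond => [[nE a_tau]|[t2 n_mod]].
    move=> _ dk; rewrite nE.
    apply: (odd_bin_symmetric t_gt0 tau_dvd a_tau) => //.
    (* As a < t, the degree a + 2t already exceeds n = 2a + t, so only i = 0 and i = 1 occur. *)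
    case: i {le_ic dk} le_k => [|[|i]]; [by left; lia | by right; lia | nia].
  have tE := two_power_least t_gt0 t2 tau_appears tau_least.
  rewrite tE in n_mod le_k *; apply: odd_bin_antipodal => //.
  rewrite n_mod -(modnMDl i (2 * a + _)); congr (_ %% _)%N; lia.
split=> // t_gt1; split; last first.
  by move=> cond i le_ic; case: (splits cond i le_ic).
move=> ex; have exact_at k i : k = (a + i * t)%N -> (k <= n)%N ->
    exact_in_degree F n t k%:Z.
  by move=> -> /c_max; exact: ex.
have n_mod : n = 2 * a + t %[mod 2 * t].
  apply/esym/eqP; apply: contraT => /eqP ne.
  have [i [le_in n_lt lt_n]] := exists_middle_degree t_gt0 a_lt_t a_le_n ne.
  case: (middle_not_exact charF n_gt0 le_in t_gt1 n_lt lt_n).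
  exact: exact_at le_in.
have [t2|t_ne] := eqVneq t (2 ^ tau)%N; first by right; split=> //; exists tau.
have tau_lt : (2 ^ tau < t)%N by rewrite ltn_neqAle eq_sym t_ne dvdn_leq.
(* The parity is digit tau of 2^tau + t, and adding 2^tau turns the digit 1 of t at that place into
   0. *)
have ev : ~~ odd 'C(2 ^ tau + t, 2 ^ tau).
  rewrite odd_bin_pow2 divnDl ?dvdnn // divnn expn_gt0 add1n /= negbK.
  exact: tau_appears.
have n_ge : (2 * a + t <= n)%N.
  rewrite leqNgt; apply/negP => n_lt.
  case: (middle_not_exact charF n_gt0 a_le_n t_gt1 n_lt _); first lia.
  by apply: (exact_at _ 0%N); lia.
left; split.
  apply/eqP; rewrite eqn_leq n_ge andbT leqNgt; apply/negP => n_gt.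
  (* Degree a + t is split as (a + 1) + (t - 1): then 2m + j = 2a + t + 1 <= n, and j = t - 1 is at
     least 2^tau. *)
  apply: (@tail_not_exact F n charF a.+1 t.-1 t _ _ _ ev); try lia.
  by apply: (exact_at _ 1%N); lia.
rewrite ltnNge; apply/negP => tau_a.
(* Without 2-cycles the vector is a single a-subset, killed by step t because a < t but not by step
   2^tau <= a. *)
apply: (@tail_not_exact F n charF 0 a t _ _ _ ev); try lia.
by apply: (exact_at _ 0%N); lia.
Qed.
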